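(* For every integer $d\geq 1$, every integer $f\geq 1$ and every integer $g\geq\max(f+1,d-1)$, the 3-sumfree sequence $S_{f,g,g+d}$ is ultimately periodic.
   Context: For positive integers $f<g<h$, the (greedy, strict) 3-sumfree sequence $S_{f,g,h}=(s_1,s_2,s_3,\ldots)$ is defined by $s_1=f$, $s_2=g$, $s_3=h$, and, for $n>3$, $s_n$ is the smallest integer exceeding $s_{n-1}$ that is not equal to the sum of three different elements among $s_1,\ldots,s_{n-1}$. The characteristic sequence of a strictly increasing sequence $S$ of positive integers is $C=(C_1,C_2,\ldots)$ with $C_z=1$ if $z$ is an entry of $S$ and $C_z=0$ otherwise. The sequence $S$ is called ultimately periodic if its characteristic sequence $C$ is ultimately periodic (equivalently, its sequence of first differences $(s_{n+1}-s_n)_{n\geq 1}$ is ultimately periodic). *)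

(* Defs.v *)
From mathcomp Require Import all_boot.
From mathcomp Require Import boolp.

Set Implicit Arguments.
Unset Strict Implicit.
Unset Printing Implicit Defensive.

Definition is_sum3 (l : seq nat) (m : nat) : bool :=
  has (fun a => has (fun b => has (fun c =>
    [&& a != b, a != c, b != c & m == a + b + c]) l) l) l.

Lemma next3_exists (l : seq nat) :
  exists m, (last 0 l < m) && ~~ is_sum3 l m.
Proof.
have le_sumn x : x \in l -> x <= sumn l.
  by move=> xl; rewrite sumnE (big_rem x xl) leq_addr.
exists (sumn l + sumn l + sumn l).+1; apply/andP; split.
  rewrite ltnS; case: l le_sumn => [|x l] // le_sumn.
  by rewrite -addnA (leq_trans (le_sumn _ _)) ?leq_addr //= mem_last.
apply/negP => /hasP[a al] /hasP[b bl] /hasP[c cl] /and4P[_ _ _ /eqP eqm].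
have := leq_add (leq_add (le_sumn _ al) (le_sumn _ bl)) (le_sumn _ cl).
by rewrite -eqm ltnn.
Qed.

Definition next3 (l : seq nat) : nat := ex_minn (next3_exists l).

(* The first n + 3 terms of S_{f,g,h}. *)
Fixpoint sumfree3_prefix (f g h n : nat) : seq nat :=
  if n is n'.+1 then
    let l := sumfree3_prefix f g h n' in rcons l (next3 l)
  else [:: f; g; h].

(* Indexed from 0: sumfree3 f g h n is the term s_{n+1} of S_{f,g,h}. *)
Definition sumfree3 (f g h : nat) (n : nat) : nat :=
  nth 0 (sumfree3_prefix f g h n) n.

(* The argument 0 is allowed, with value 0 when all s n are positive. *)
Definition char_seq (s : nat -> nat) (z : nat) : nat :=
  if `[< exists n, s n = z >] then 1 else 0.

Definition ultimately_periodic (T : Type) (u : nat -> T) : Prop :=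
  exists N p : nat, 0 < p /\ forall z, N <= z -> u (z + p) = u z.

(* Main.v *)
Require Import Defs.
From mathcomp Require Import all_boot.
From mathcomp Require Import boolp.
From mathcomp Require Import zify.

(** The greedy sequence is the only set P of integers that has the right terms
    up to h, contains no sum of three of its distinct elements, and contains
    every larger integer that is not such a sum.  So it is enough to exhibit a
    periodic P with these properties ([greedy_model_periodic]).  Write h = g + d.

    After f and g the greedy rule takes the whole interval
    I = [g + d, f + 2g + d - 1], because f + g + h is the first sum.  From then
    on it takes one block of consecutive integers at a time.  After a block B
    the sums f + g + B, f + I + B, g + I + B and I + I + B (two distinct elements
    of I) fill a long gap without leaving a hole, and the next block begins just
    after the largest element of I + I + B.  Sums with two or three elements in
    the blocks fall into the gaps again, so that the pattern repeats.

    - If d >= 2, d < f + g and f + g >= 4, all blocks after I have length f + g and are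
      spaced by 3f + 5g + 2d - 3 ([single_blocks]).
    - If d = 1, f plus one element of each of two different blocks hits the last
      element that such a block would have.  Blocks lose that element at every
      second step and two lengths alternate ([alternating_blocks]).
    - If d >= f + g, then f = 1 and g = d - 1.  The sums f + g + I end at 4d - 2
      and f + I + I begins at 4d, so that 4d - 1 enters the sequence.  From then
      on the blocks have length d and period 8d - 3 ([extremal_blocks]),
      provided that I + I + I reaches the beginning 8d - 2 of I + I + (4d - 1);
      this needs d >= 6.

    In each family the three properties are inequalities between the ends of
    intervals, once multiples of the period are compared by [dvdn_gap].  The
    sequences starting with 1,2,4; 1,2,5; 1,3,7 and 1,4,9 remain, where some
    gap is not filled.  Each of them agrees with an explicit periodic table,
    and a finite computation suffices to see this ([certified_periodic]). *)

Set Implicit Arguments.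
Unset Strict Implicit.
Unset Printing Implicit Defensive.

(** * Sets with the greedy property *)

Definition sum3 (P : nat -> Prop) (z : nat) : Prop :=
  exists a b c, [/\ P a, P b, P c, a < b < c & z = a + b + c].

Lemma sum3_distinct (P : nat -> Prop) a b c :
  P a -> P b -> P c -> a != b -> a != c -> b != c -> sum3 P (a + b + c).
Proof.
move=> Pa Pb Pc ab ac bc.
have [lab|lab] := ltnP a b; have [lbc|lbc] := ltnP b c;
  have [lac|lac] := ltnP a c; try lia.
- by exists a, b, c; split=> //; lia.
- by exists a, c, b; split=> //; lia.
- by exists c, a, b; split=> //; lia.
- by exists b, a, c; split=> //; lia.
- by exists b, c, a; split=> //; lia.
- by exists c, b, a; split=> //; lia.
Qed.

(** The last two clauses together say that z > h belongs to P exactly when it is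
    not a sum.  They are kept apart because they have different proofs:
    one compares residues, the other covers gaps by sumsets of intervals. *)
Record greedy_model (f g h : nat) (P : nat -> Prop) : Prop := GreedyModel {
  greedy_init : forall z, z <= h -> P z <-> [\/ z = f, z = g | z = h];
  greedy_sumfree : forall a b c,
    P a -> P b -> P c -> a < b < c -> ~ P (a + b + c);
  greedy_complete : forall z, h < z -> P z \/ sum3 P z }.

Section Prefix.

Variables (f g h : nat) (P : nat -> Prop).
Hypotheses (lt_fg : f < g) (lt_gh : g < h) (modelP : greedy_model f g h P).

Local Notation prefix := (sumfree3_prefix f g h).

Lemma greedy_model_sum3 z : h < z -> P z <-> ~ sum3 P z.
Proof.
move=> lt_hz; split=> [Pz [a [b [c [Pa Pb Pc ltabc def_z]]]]|].
  by apply: (greedy_sumfree modelP Pa Pb Pc ltabc); rewrite -def_z.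
by case: (greedy_complete modelP lt_hz).
Qed.

Lemma next3P l : [/\ last 0 l < next3 l, ~~ is_sum3 l (next3 l) &
  forall m, last 0 l < m -> m < next3 l -> is_sum3 l m].
Proof.
rewrite /next3; case: ex_minnP => n /andP[lt_n nsum_n] min_n.
split=> // m lt_m lt_mn; apply/negPn/negP => nsum_m.
by have := min_n m; rewrite lt_m nsum_m => /(_ isT); lia.
Qed.

(** Each prefix consists of all elements of P up to its last term m.  Since the
    summands of a sum of three elements of P are smaller than the sum, [is_sum3]
    on the prefix decides whether an integer up to the next term is a sum in P. *)
Lemma mem_prefix n : h + n <= last 0 (prefix n) /\
  forall z, z \in prefix n <-> P z /\ z <= last 0 (prefix n).
Proof.
elim: n => [|n [le_hL memL]].
  split=> [|z] /=; first by rewrite addn0.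
  rewrite !inE; split=> [/or3P zE|[Pz le_zh]].
    have le_zh : z <= h by case: zE => /eqP->; lia.
    by split=> //; apply/(greedy_init modelP le_zh); case: zE => /eqP;
       [constructor 1 | constructor 2 | constructor 3].
  by case: ((greedy_init modelP le_zh).1 Pz) => ->; rewrite eqxx ?orbT.
have [ltL nsum_next min_next] := next3P (prefix n).
rewrite [prefix n.+1]/= last_rcons.
set L := last 0 _ in le_hL memL ltL min_next *.
set m := next3 _ in ltL nsum_next min_next *.
have sumP z : is_sum3 (prefix n) z -> sum3 P z.
  move=> /hasP[a /memL[Pa _]] /hasP[b /memL[Pb _]] /hasP[c /memL[Pc _]].
  by move=> /and4P[ab ac bc /eqP->]; apply: sum3_distinct.
have notP z : L < z -> z < m -> ~ P z.
  move=> lt_Lz lt_zm /greedy_model_sum3 -/(_ _) nsum; apply: nsum; first lia.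
  exact: sumP (min_next _ lt_Lz lt_zm).
have Pm : P m.
  apply/greedy_model_sum3; first lia.
  move=> [a [b [c [Pa Pb Pc ltabc def_m]]]].
  have mem x : P x -> x < m -> x \in prefix n.
    move=> Px lt_xm; apply/memL; split=> //; rewrite leqNgt; apply/negP.
    by move=> lt_Lx; apply: notP Px.
  case/negP: nsum_next.
  apply/hasP; exists a; first by apply: mem => //; lia.
  apply/hasP; exists b; first by apply: mem => //; lia.
  by apply/hasP; exists c; [apply: mem => //; lia | lia].
split=> [|z]; first lia.
rewrite mem_rcons in_cons; split=> [/predU1P[->//|/memL[Pz le_zL]]|[Pz le_zm]].
  by split=> //; lia.
have [//|neq_zm] := eqVneq z m; apply/memL; split=> //.
rewrite leqNgt; apply/negP => lt_Lz; apply: (notP z) => //; lia.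
Qed.

Lemma size_prefix n : size (prefix n) = n + 3.
Proof. by elim: n => //= n IHn; rewrite size_rcons IHn. Qed.

Lemma nth_prefix n m i : i < n + 3 ->
  nth 0 (prefix (m + n)) i = nth 0 (prefix n) i.
Proof.
move=> lt_i; elim: m => //= m IHm.
by rewrite nth_rcons size_prefix ifT //; lia.
Qed.

Lemma sumfree3_range z : (exists n, sumfree3 f g h n = z) <-> P z.
Proof.
split=> [[n <-]|Pz].
  have: sumfree3 f g h n \in prefix n.
    by apply: mem_nth; rewrite size_prefix; lia.
  by case/(mem_prefix n).2.
have [le_z memz] := mem_prefix z.
have /(nthP 0)[i lt_i <-] : z \in prefix z by apply/memz; split=> //; lia.
exists i; rewrite size_prefix in lt_i.
rewrite /sumfree3 -(nth_prefix z (i:=i)) ?ltnS; last lia.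
by rewrite addnC nth_prefix.
Qed.

Lemma greedy_model_periodic N p : 0 < p ->
    (forall z, N <= z -> P (z + p) <-> P z) ->
  ultimately_periodic (char_seq (sumfree3 f g h)).
Proof.
move=> p_gt0 perP; exists N, p; split=> // z le_Nz; rewrite /char_seq.
suff -> : (exists n, sumfree3 f g h n = z + p) =
          (exists n, sumfree3 f g h n = z) by [].
by rewrite propeqE !sumfree3_range; apply: perP.
Qed.

End Prefix.

(** * Sums of elements of intervals *)

Definition full (P : nat -> Prop) (lo hi : nat) : Prop :=
  forall x, lo <= x <= hi -> P x.

Section Intervals.

Variables (P : nat -> Prop).

Lemma full1 a : P a -> full P a a.
Proof. by move=> Pa x /andP[ge_x le_x]; have <- : a = x by lia. Qed.

Lemma split_sum l1 h1 l2 h2 w : l1 <= h1 -> l2 <= h2 ->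
    l1 + l2 <= w <= h1 + h2 ->
  exists x y, [/\ l1 <= x <= h1, l2 <= y <= h2 & w = x + y].
Proof.
move=> le1 le2 hw; have [le_w|lt_w] := leqP w (h1 + l2).
  by exists (w - l2), l2; split; lia.
by exists h1, (w - h1); split; lia.
Qed.

Lemma split_sum_lt l h w : l.*2 < w < h.*2 ->
  exists x y, [/\ l <= x, x < y, y <= h & w = x + y].
Proof.
move=> hw; have [le_w|lt_w] := leqP w (l + h).
  by exists l, (w - l); split; lia.
by exists (w - h), h; split; lia.
Qed.

Lemma sum3_intervals l1 h1 l2 h2 l3 h3 z :
    full P l1 h1 -> full P l2 h2 -> full P l3 h3 ->
    l1 <= h1 < l2 -> l2 <= h2 < l3 -> l3 <= h3 ->
  l1 + l2 + l3 <= z <= h1 + h2 + h3 -> sum3 P z.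
Proof.
move=> P1 P2 P3 lt1 lt2 lt3 hz.
have [||//|w [c [hw hc ->]]] := @split_sum (l1 + l2) (h1 + h2) l3 h3 z; try lia.
have [||//|a [b [ha hb ->]]] := @split_sum l1 h1 l2 h2 w; try lia.
by exists a, b, c; split; [apply: P1|apply: P2|apply: P3| |]; lia.
Qed.

Lemma sum3_pair_left l1 h1 l2 h2 z :
    full P l1 h1 -> full P l2 h2 -> l1 < h1 < l2 -> l2 <= h2 ->
  l1.*2 + l2 < z < h1.*2 + h2 -> sum3 P z.
Proof.
move=> P1 P2 lt1 lt2 hz.
have [|||w [c [hw hc ->]]] := @split_sum l1.*2.+1 h1.*2.-1 l2 h2 z; try lia.
have [|a [b [ha ab hb ->]]] := @split_sum_lt l1 h1 w; first lia.
by exists a, b, c; split; [apply: P1|apply: P1|apply: P2| |]; lia.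
Qed.

Lemma sum3_pair_right l1 h1 l2 h2 z :
    full P l1 h1 -> full P l2 h2 -> l1 <= h1 < l2 -> l2 < h2 ->
  l1 + l2.*2 < z < h1 + h2.*2 -> sum3 P z.
Proof.
move=> P1 P2 lt1 lt2 hz.
have [|||a [w [ha hw ->]]] := @split_sum l1 h1 l2.*2.+1 h2.*2.-1 z; try lia.
have [|b [c [hb bc hc ->]]] := @split_sum_lt l2 h2 w; first lia.
by exists a, b, c; split; [apply: P1|apply: P2|apply: P2| |]; lia.
Qed.

Lemma sum3_triple l h z : full P l h -> l.+1 < h ->
  3 * l.+1 <= z <= 3 * h.-1 -> sum3 P z.
Proof.
move=> Plh lt_lh hz; have [le_z|lt_z] := leqP z (l + h + h.-1).
  have [|b [c [hb bc hc def_w]]] := @split_sum_lt l.+1 h (z - l); first lia.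
  by exists l, b, c; split; try (apply: Plh); lia.
have [|a [b [ha ab hb def_w]]] := @split_sum_lt l h.-1 (z - h); first lia.
by exists a, b, h; split; try (apply: Plh); lia.
Qed.

End Intervals.

(** * Multiples of the period *)

(** A member of a block is a multiple of p plus a residue.  In an equation between
    a member and a sum of three members, this trichotomy is all that has to be
    known about the multiples; the rest is linear. *)
Lemma dvdn_gap p m n : p %| m -> p %| n ->
  [\/ p + m <= n, m = n | p + n <= m].
Proof.
move=> /dvdnP[i ->] /dvdnP[j ->]; have [lt_ij|lt_ji|->] := ltngtP i j.
- by constructor 1; rewrite -mulSn leq_mul2r lt_ij orbT.
- by constructor 3; rewrite -mulSn leq_mul2r lt_ji orbT.
by constructor 2.
Qed.

Lemma block_index p o z : 0 < p -> o <= z ->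
  exists k r, [/\ z = k * p + r & o <= r < p + o].
Proof.
move=> p_gt0 le_oz; exists ((z - o) %/ p), ((z - o) %% p + o).
have := divn_eq (z - o) p; have := ltn_pmod (z - o) p_gt0; split; lia.
Qed.

(** * Blocks of equal length *)

Section SingleBlocks.

Variables (d f g : nat).
Hypotheses (d_gt1 : 1 < d) (f_gt0 : 0 < f) (lt_fg : f < g) (lt_dfg : d < f + g)
  (fg_gt3 : 3 < f + g).

Let p := 3 * f + 5 * g + 2 * d - 3.

Definition single_blocks (z : nat) : Prop :=
  [\/ z = f, z = g, g + d <= z < f + 2 * g + d |
      exists2 k, 0 < k & k * p + (g + d - 2) <= z <= k * p + (f + 2 * g + d - 3)].

Let single_blocks_view z : single_blocks z -> exists m r,
  [/\ z = m + r, p %| m &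
  [\/ m = 0 /\ r = f, m = 0 /\ r = g, m = 0 /\ g + d <= r < f + 2 * g + d |
      p <= m /\ g + d - 2 <= r <= f + 2 * g + d - 3]].
Proof.
case=> [->|->|hz|[k k_gt0 hz]].
- by exists 0, f; split; [|exact: dvdn0|constructor 1].
- by exists 0, g; split; [|exact: dvdn0|constructor 2].
- by exists 0, z; split; [|exact: dvdn0|constructor 3].
exists (k * p), (z - k * p); split; [lia|exact: dvdn_mull|constructor 4].
by rewrite leq_pmull //; split=> //; lia.
Qed.

Lemma single_blocks_sumfree a b c : single_blocks a -> single_blocks b ->
  single_blocks c -> a < b < c -> ~ single_blocks (a + b + c).
Proof.
have Ep : p = 3 * f + 5 * g + 2 * d - 3 by [].
move=> /single_blocks_view[i [r [-> di hr]]] /single_blocks_view[j [s [-> dj hs]]].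
move=> /single_blocks_view[l [t [-> dl ht]]] lt /single_blocks_view[k [u [E dk hu]]].
have := dvdn_gap dk (dvdn_add (dvdn_add di dj) dl).
clear di dj dl dk; clearbody p => cmp.
case: hr => hr; case: hs => hs; try lia; case: ht => ht; try lia;
  case: cmp => cmp; case: hu => hu; try lia.
Qed.

(** The gaps after the interval I and after a later block are covered from left
    to right by consecutive sumsets; f + g >= 4 closes the hole that would
    otherwise appear before I + I + I when d = 2. *)
Lemma single_blocks_complete z : g + d < z -> single_blocks z \/ sum3 single_blocks z.
Proof.
have Ep : p = 3 * f + 5 * g + 2 * d - 3 by [].
have Pf : full single_blocks f f by apply: full1; constructor 1.
have Pg : full single_blocks g g by apply: full1; constructor 2.
have PI : full single_blocks (g + d) (f + 2 * g + d - 1).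
  by move=> x hx; constructor 3; lia.
have PB k : 0 < k ->
    full single_blocks (k * p + (g + d - 2)) (k * p + (f + 2 * g + d - 3)).
  by move=> k_gt0 x hx; constructor 4; exists k.
move=> lt_z; have [||k [r [def_z hr]]] := @block_index p (g + d - 2) z; try lia.
rewrite {z}def_z in lt_z *.
case: (posnP k) lt_z => [->|k_gt0]; rewrite ?mul0n ?add0n => lt_z.
  have [hI|hI] := ltnP r (f + 2 * g + d); first by left; apply: PI; lia.
  right; have [h1|h1] := ltnP r (2 * f + 3 * g + d).
    by apply: (sum3_intervals Pf Pg PI); lia.
  have [h2|h2] := ltnP r (3 * f + 4 * g + 2 * d - 2).
    by apply: (sum3_pair_right Pf PI); lia.
  have [h3|h3] := ltnP r (2 * f + 5 * g + 2 * d - 2).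
    by apply: (sum3_pair_right Pg PI); lia.
  by apply: (sum3_triple PI); lia.
have lek : p <= k * p by rewrite leq_pmull.
have {PB} := PB k k_gt0; move: (k * p) lek lt_z => K lek lt_z PB.
have [hI|hI] := ltnP r (f + 2 * g + d - 2); first by left; apply: PB; lia.
right; have [h1|h1] := ltnP r (2 * f + 3 * g + d - 2).
  by apply: (sum3_intervals Pf Pg PB); lia.
have [h2|h2] := ltnP r (3 * f + 4 * g + 2 * d - 3).
  by apply: (sum3_intervals Pf PI PB); lia.
have [h3|h3] := ltnP r (2 * f + 5 * g + 2 * d - 3).
  by apply: (sum3_intervals Pg PI PB); lia.
by apply: (sum3_pair_left PI PB); lia.
Qed.

Lemma single_blocks_init z : z <= g + d ->
  single_blocks z <-> [\/ z = f, z = g | z = g + d].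
Proof.
move=> le_z; split=> [[||hz|[k k_gt0 hz]]|[]].
- by constructor 1.
- by constructor 2.
- by constructor 3; lia.
- have : p <= k * p by rewrite leq_pmull.
  rewrite {1}/p; lia.
- by constructor 1.
- by constructor 2.
by constructor 3; lia.
Qed.

Lemma single_blocks_periodic z : f + 2 * g + d <= z ->
  single_blocks (z + p) <-> single_blocks z.
Proof.
move=> le_z; split=> [[||hz|[[//|k] _ hz]]|[||hz|[k k_gt0 hz]]]; try lia.
  case: (posnP k) hz => [->|k_gt0]; rewrite mulSn => hz; first lia.
  by constructor 4; exists k => //; lia.
by constructor 4; exists k.+1; rewrite ?mulSn //; lia.
Qed.

Lemma periodic_single_blocks :
  ultimately_periodic (char_seq (sumfree3 f g (g + d))).
Proof.
apply: (@greedy_model_periodic f g (g + d) single_blocks _ _ _ (f + 2 * g + d) p).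
- by [].
- lia.
- split; [exact: single_blocks_init|exact: single_blocks_sumfree|exact: single_blocks_complete].
- by rewrite /p; lia.
- exact: single_blocks_periodic.
Qed.

End SingleBlocks.

(** * Blocks of alternating length *)

Section AlternatingBlocks.

Variables (f g : nat).
Hypotheses (f_gt0 : 0 < f) (lt_fg : f < g).

Let p := 3 * f + 5 * g - 1.
Let q := p + p - 1.

(** Since h = g + 1, the element g is the left neighbour of the first interval and
    is counted as a member of it.  The booleans are the corrections at k = 0:
    the first block of the first kind has one more element on the right, the
    first block of the second kind has one more on the left. *)
Definition alternating_blocks (z : nat) : Prop :=
  [\/ z = f,
      exists k, k * q + g <= z <= k * q + (f + 2 * g - (0 < k)) |
      exists k, k * q + p + (g - (k == 0)) <= z <= k * q + p + (f + 2 * g - 2)].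

Let alternating_blocks_view z : alternating_blocks z -> exists m r,
  [/\ z = m + r, q %| m &
  [\/ m = 0 /\ (r = f \/ g <= r <= f + 2 * g), m = 0 /\ p + g - 1 <= r <= p + f + 2 * g - 2,
      q <= m /\ g <= r <= f + 2 * g - 1 | q <= m /\ p + g <= r <= p + f + 2 * g - 2]].
Proof.
case=> [->|[k hz]|[k hz]].
- by exists 0, f; split; [|exact: dvdn0|constructor 1; lia].
- exists (k * q), (z - k * q); split; [lia|exact: dvdn_mull|].
  case: (posnP k) hz => [->|k_gt0] hz; first by constructor 1; lia.
  by constructor 3; rewrite leq_pmull //; lia.
exists (k * q), (z - k * q); split; [lia|exact: dvdn_mull|].
case: (posnP k) hz => [->|k_gt0] hz; first by constructor 2; lia.
by constructor 4; rewrite leq_pmull //; lia.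
Qed.

Lemma alternating_blocks_sumfree a b c : alternating_blocks a ->
  alternating_blocks b -> alternating_blocks c -> a < b < c ->
  ~ alternating_blocks (a + b + c).
Proof.
have Ep : p = 3 * f + 5 * g - 1 by [].
have Eq : q = p + p - 1 by [].
move=> /alternating_blocks_view[i [r [-> di hr]]].
move=> /alternating_blocks_view[j [s [-> dj hs]]].
move=> /alternating_blocks_view[l [t [-> dl ht]]] lt.
move=> /alternating_blocks_view[k [u [E dk hu]]].
(* Since p + p = q + 1, two summands from blocks of the second kind move the sum
   one whole period ahead, so that two comparisons are needed. *)
have dn := dvdn_add (dvdn_add di dj) dl.
have := dvdn_gap dk dn; have := dvdn_gap dk (dvdn_add (dvdnn q) dn).
clear di dj dl dk dn; clearbody p q => cmp2 cmp1.
have {cmp1 cmp2} : [\/ q + k <= i + j + l, k = i + j + l, k = q + (i + j + l) |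
  q + (q + (i + j + l)) <= k].
  case: cmp1 => cmp1; [by constructor 1|by constructor 2|].
  case: cmp2 => cmp2; [lia|by constructor 3|by constructor 4].
case: hr => hr; case: hs => hs; try lia; case: ht => ht; try lia;
  case=> cmp; case: hu => hu; try lia.
Qed.

Lemma alternating_blocks_complete z : g + 1 < z ->
  alternating_blocks z \/ sum3 alternating_blocks z.
Proof.
have Ep : p = 3 * f + 5 * g - 1 by [].
have Eq : q = p + p - 1 by [].
have Pf : full alternating_blocks f f by apply: full1; constructor 1.
have PI : full alternating_blocks g (f + 2 * g).
  by move=> x hx; constructor 2; exists 0; lia.
have PM : full alternating_blocks (p + (g - 1)) (p + (f + 2 * g - 2)).
  by move=> x hx; constructor 3; exists 0; lia.
have PE k : full alternating_blocks (k * q + g) (k * q + (f + 2 * g - 1)).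
  by move=> x hx; constructor 2; exists k; lia.
have PO k : full alternating_blocks (k * q + p + g) (k * q + p + (f + 2 * g - 2)).
  by move=> x hx; constructor 3; exists k; lia.
move=> lt_z; have [||k [r [def_z hr]]] := @block_index q g z; try lia.
rewrite {z}def_z in lt_z *.
case: (posnP k) lt_z => [->|k_gt0]; rewrite ?mul0n ?add0n => lt_z.
  have [hI|hI] := leqP r (f + 2 * g); first by left; apply: PI; lia.
  have [h1|h1] := ltnP r (3 * f + 4 * g).
    by right; apply: (sum3_pair_right Pf PI); lia.
  have [h2|h2] := ltnP r (p + (g - 1)).
    by right; apply: (sum3_triple PI); lia.
  have [h3|h3] := leqP r (p + (f + 2 * g - 2)); first by left; apply: PM; lia.
  right; have [h4|h4] := ltnP r (p + (3 * f + 4 * g - 1)).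
    by apply: (sum3_intervals Pf PI PM); lia.
  by apply: (sum3_pair_left PI PM); lia.
have lek : q <= k * q by rewrite leq_pmull.
have := PE k; have := PO k; move: (k * q) lek lt_z => K lek lt_z {}PO {}PE.
have [hI|hI] := leqP r (f + 2 * g - 1); first by left; apply: PE; lia.
have [h1|h1] := ltnP r (3 * f + 4 * g).
  by right; apply: (sum3_intervals Pf PI PE); lia.
have [h2|h2] := ltnP r (p + g).
  by right; apply: (sum3_pair_left PI PE); lia.
have [h3|h3] := leqP r (p + (f + 2 * g - 2)); first by left; apply: PO; lia.
(* f + I + block begins one step too late here; the missing integer is the sum
   of f, the extra element p + g - 1 and k q + g. *)
right; have [h4|h4] := leqP r (p + (f + 2 * g - 1)).
  by apply: (sum3_intervals Pf PM PE); lia.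
have [h5|h5] := ltnP r (p + (3 * f + 4 * g - 1)).
  by apply: (sum3_intervals Pf PI PO); lia.
by apply: (sum3_pair_left PI PO); lia.
Qed.

Lemma alternating_blocks_init z : z <= g + 1 ->
  alternating_blocks z <-> [\/ z = f, z = g | z = g + 1].
Proof.
move=> le_z; split=> [[|[k hz]|[k hz]]|[]].
- by constructor 1.
- case: (posnP k) hz => [->|k_gt0] hz; first by case: (eqVneq z g) => ?;
    [constructor 2 | constructor 3; lia].
  have : q <= k * q by rewrite leq_pmull.
  rewrite {1}/q /p; lia.
- by rewrite /p in hz; lia.
- by constructor 1.
- by constructor 2; exists 0; lia.
by constructor 2; exists 0; lia.
Qed.

Lemma alternating_blocks_periodic z : p + f + 2 * g <= z ->
  alternating_blocks (z + q) <-> alternating_blocks z.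
Proof.
move=> le_z; split=> [[|[k hz]|[k hz]]|[|[k hz]|[k hz]]]; try lia.
- case: k hz => [|k]; rewrite ?mulSn => hz; first lia.
  by constructor 2; exists k; case: (posnP k) hz => [->|] hz; lia.
- case: k hz => [|k]; rewrite ?mulSn => hz; first by rewrite /q in hz; lia.
  by constructor 3; exists k; case: (posnP k) hz => [->|] hz; lia.
- by constructor 2; exists k.+1; case: (posnP k) hz => [->|] hz; rewrite mulSn; lia.
by constructor 3; exists k.+1; case: (posnP k) hz => [->|] hz; rewrite mulSn; lia.
Qed.

Lemma periodic_alternating_blocks :
  ultimately_periodic (char_seq (sumfree3 f g (g + 1))).
Proof.
apply: (@greedy_model_periodic f g (g + 1) alternating_blocks _ _ _
          (p + f + 2 * g) q).
- by [].
- lia.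
- split; [exact: alternating_blocks_init|exact: alternating_blocks_sumfree|
    exact: alternating_blocks_complete].
- by rewrite /q /p; lia.
- exact: alternating_blocks_periodic.
Qed.

End AlternatingBlocks.

(** * Blocks for f = 1 and g = d - 1 *)

Section ExtremalBlocks.

Variable d : nat.
Hypothesis d_ge6 : 5 < d.

Let p := 8 * d - 3.

Definition extremal_blocks (z : nat) : Prop :=
  [\/ z = 1 \/ z = d - 1, 2 * d - 1 <= z <= 3 * d - 2, z = 4 * d - 1 |
      exists2 k, 0 < k & k * p + (2 * d - 2) <= z <= k * p + (3 * d - 3)].

Let extremal_blocks_view z : extremal_blocks z -> exists m r,
  [/\ z = m + r, p %| m &
  [\/ m = 0 /\ (r = 1 \/ r = d - 1), m = 0 /\ 2 * d - 1 <= r <= 3 * d - 2,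
      m = 0 /\ r = 4 * d - 1 | p <= m /\ 2 * d - 2 <= r <= 3 * d - 3]].
Proof.
case=> [hz|hz|->|[k k_gt0 hz]].
- by exists 0, z; split; [|exact: dvdn0|constructor 1].
- by exists 0, z; split; [|exact: dvdn0|constructor 2].
- by exists 0, (4 * d - 1); split; [|exact: dvdn0|constructor 3].
exists (k * p), (z - k * p); split; [lia|exact: dvdn_mull|constructor 4].
by rewrite leq_pmull //; split=> //; lia.
Qed.

Lemma extremal_blocks_sumfree a b c : extremal_blocks a -> extremal_blocks b ->
  extremal_blocks c -> a < b < c -> ~ extremal_blocks (a + b + c).
Proof.
have Ep : p = 8 * d - 3 by [].
move=> /extremal_blocks_view[i [r [-> di hr]]].
move=> /extremal_blocks_view[j [s [-> dj hs]]].
move=> /extremal_blocks_view[l [t [-> dl ht]]] lt.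
move=> /extremal_blocks_view[k [u [E dk hu]]].
have := dvdn_gap dk (dvdn_add (dvdn_add di dj) dl).
clear di dj dl dk; clearbody p => cmp.
case: hr => hr; case: hs => hs; try lia; case: ht => ht; try lia;
  case: cmp => cmp; case: hu => hu; lia.
Qed.

Lemma extremal_blocks_complete z : 2 * d - 1 < z ->
  extremal_blocks z \/ sum3 extremal_blocks z.
Proof.
have Ep : p = 8 * d - 3 by [].
have P1 : full extremal_blocks 1 1 by apply: full1; constructor 1; left.
have Pg : full extremal_blocks (d - 1) (d - 1).
  by apply: full1; constructor 1; right.
have PI : full extremal_blocks (2 * d - 1) (3 * d - 2).
  by move=> x hx; constructor 2.
have PE : full extremal_blocks (4 * d - 1) (4 * d - 1).
  by apply: full1; constructor 3.
have PB k : 0 < k ->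
    full extremal_blocks (k * p + (2 * d - 2)) (k * p + (3 * d - 3)).
  by move=> k_gt0 x hx; constructor 4; exists k.
move=> lt_z; have [||k [r [def_z hr]]] := @block_index p (2 * d - 2) z; try lia.
rewrite {z}def_z in lt_z *.
case: (posnP k) lt_z => [->|k_gt0]; rewrite ?mul0n ?add0n => lt_z.
  have [hI|hI] := leqP r (3 * d - 2); first by left; apply: PI; lia.
  have [h1|h1] := ltnP r (4 * d - 1).
    by right; apply: (sum3_intervals P1 Pg PI); lia.
  have [hE|hE] := leqP r (4 * d - 1); first by left; apply: PE; lia.
  right; have [h2|h2] := leqP r (6 * d - 4).
    by apply: (sum3_pair_right P1 PI); lia.
  have [h3|h3] := leqP r (7 * d - 6).
    by apply: (sum3_pair_right Pg PI); lia.
  (* 9 d - 9 is the largest sum in I + I + I; the next sumset starts at 8 d - 2,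
     which is where d >= 6 is used. *)
  have [h4|h4] := leqP r (9 * d - 9).
    by apply: (sum3_triple PI); lia.
  by apply: (sum3_pair_left PI PE); lia.
have lek : p <= k * p by rewrite leq_pmull.
have {PB} := PB k k_gt0; move: (k * p) lek lt_z => K lek lt_z PB.
have [hI|hI] := leqP r (3 * d - 3); first by left; apply: PB; lia.
right; have [h1|h1] := leqP r (4 * d - 3).
  by apply: (sum3_intervals P1 Pg PB); lia.
have [h2|h2] := leqP r (6 * d - 4).
  by apply: (sum3_intervals P1 PI PB); lia.
have [h3|h3] := leqP r (7 * d - 6).
  by apply: (sum3_intervals Pg PI PB); lia.
have [h4|h4] := leqP r (9 * d - 8).
  by apply: (sum3_pair_left PI PB); lia.
by apply: (sum3_intervals PI PE PB); lia.
Qed.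

Lemma extremal_blocks_init z : z <= 2 * d - 1 ->
  extremal_blocks z <-> [\/ z = 1, z = d - 1 | z = 2 * d - 1].
Proof.
move=> le_z; split=> [[[]|hz|hz|[k k_gt0 hz]]|[]].
- by constructor 1.
- by constructor 2.
- by constructor 3; lia.
- lia.
- have : p <= k * p by rewrite leq_pmull.
  rewrite {1}/p; lia.
- by constructor 1; left.
- by constructor 1; right.
by constructor 2; lia.
Qed.

Lemma extremal_blocks_periodic z : 4 * d <= z ->
  extremal_blocks (z + p) <-> extremal_blocks z.
Proof.
move=> le_z; split=> [[[]|hz|hz|[[//|k] _ hz]]|[[]|hz|hz|[k k_gt0 hz]]]; try lia.
  case: (posnP k) hz => [->|k_gt0]; rewrite mulSn => hz; first lia.
  by constructor 4; exists k => //; lia.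
by constructor 4; exists k.+1; rewrite ?mulSn //; lia.
Qed.

Lemma periodic_extremal_blocks :
  ultimately_periodic (char_seq (sumfree3 1 (d - 1) (2 * d - 1))).
Proof.
apply: (@greedy_model_periodic 1 (d - 1) (2 * d - 1) extremal_blocks _ _ _ (4 * d) p).
- lia.
- lia.
- split; [exact: extremal_blocks_init|exact: extremal_blocks_sumfree|
    exact: extremal_blocks_complete].
- by rewrite /p; lia.
- exact: extremal_blocks_periodic.
Qed.

End ExtremalBlocks.

(** * Finitely many exceptions *)

Section FiniteCheck.

Variables (f g h N p : nat) (s t : seq nat).

(** The initial terms below N are s, and t lists the residues modulo p, counted
    from N, of the later ones. *)
Definition table (z : nat) : bool :=
  if z < N then z \in s else (z - N) %% p \in t.

Definition table_window : seq nat := [seq a <- iota 0 (N + 3 * p) | table a].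

(** A version of [has] that stops at the first success also under call by
    value, where the disjunction in [has] is strict. *)
Definition has_first (q : pred nat) (l : seq nat) : bool := find q l < size l.

Definition table_sum3 (l : seq nat) (z : nat) : bool :=
  has_first (fun a => has_first (fun b =>
    if (a < b) && (a + b + b < z) then table (z - a - b) else false) l) l.

Definition table_no_sum3 (l : seq nat) : bool :=
  all (fun a => all (fun b => if a < b then
    all (fun c => if b < c then ~~ table (a + b + c) else true) l else true) l) l.

(** The bounds of the search are those of [table_lower] for the absence of sums and
    of [table_complete] for their existence. *)
Definition table_certificate : bool :=
  let l := table_window in
  [&& [seq a <- iota 0 h.+1 | table a] == [:: f; g; h], table_no_sum3 l &
      all (fun z => if table z then true else table_sum3 l z)
        (iota h.+1 (3 * N + p - h))].

Hypotheses (p_gt0 : 0 < p) (lt_hN : h < N) (certificate : table_certificate).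

Lemma table_periodic z i : N <= z -> table (z + i * p) = table z.
Proof.
move=> le_Nz; rewrite /table !ifF; try lia.
by rewrite -addnBAC // addnC modnMDl.
Qed.

Lemma mem_window a : (a \in table_window) = table a && (a < N + 3 * p).
Proof. by rewrite mem_filter mem_iota. Qed.

(** Of the three candidates c - p, c - 2p and c - 3p at least one differs from both
    a and b.  So a large term of a sum of distinct terms can be lowered by a
    multiple of the period, which leaves a finite range to check. *)
Lemma table_lower a b c : table c -> N + 3 * p <= c ->
  exists i, [/\ 0 < i, i * p <= c, table (c - i * p), a != c - i * p &
             b != c - i * p /\ N <= c - i * p].
Proof.
move=> tc le_c.
have tci i : i <= 3 -> table (c - i * p).
  move=> le_i; rewrite -(table_periodic i) ?subnK //; nia.
have [i [i_gt0 le_i3 ai bi]] : exists i,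
    [/\ 0 < i, i <= 3, a != c - i * p & b != c - i * p].
  have [a1|a1] := eqVneq a (c - 1 * p); have [b1|b1] := eqVneq b (c - 1 * p);
  have [a2|a2] := eqVneq a (c - 2 * p); have [b2|b2] := eqVneq b (c - 2 * p);
  first [by exists 1; split; lia | by exists 2; split; lia | by exists 3; split; lia].
exists i; split; rewrite ?tci //; try split=> //; nia.
Qed.

Lemma table_sumfree a b c : table a -> table b -> table c ->
  a != b -> a != c -> b != c -> ~~ table (a + b + c).
Proof.
have [n] := ubnP (a + b + c); elim: n => // n IHn in a b c * => lt_n.
move=> ta tb tc ab ac bc.
have step x y z : x + y + z <= n -> table x -> table y -> table z ->
    x != y -> x != z -> y != z -> N + 3 * p <= z -> ~~ table (x + y + z).
  move=> le_n tx ty tz xy xz yz le_z.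
  have [i [i_gt0 le_iz tzi xi [yi le_N]]] := table_lower x y tz le_z.
  have -> : x + y + z = (x + y + (z - i * p)) + i * p by lia.
  rewrite table_periodic; last lia.
  by apply: IHn => //; nia.
have [lt_c|le_c] := ltnP c (N + 3 * p); last by apply: step => //; lia.
have [lt_b|le_b] := ltnP b (N + 3 * p); last first.
  by rewrite addnAC; apply: step => //; lia.
have [lt_a|le_a] := ltnP a (N + 3 * p); last first.
  by rewrite -addnA addnC; apply: step => //; lia.
have inW x : table x -> x < N + 3 * p -> x \in table_window.
  by rewrite mem_window => -> ->.
have [x [y [z [xW yW zW /andP[xy yz] ->]]]] :=
  sum3_distinct (P := fun x => x \in table_window)
    (inW a ta lt_a) (inW b tb lt_b) (inW c tc lt_c) ab ac bc.
have /and3P[_ /allP/(_ x xW) + _] := certificate.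
by move=> /allP/(_ y yW); rewrite xy => /allP/(_ z zW); rewrite yz.
Qed.

(** If z > 3N is a sum of three terms, the largest term exceeds N; raising it by p
    keeps it distinct from the others and gives z + p.  So one period beyond 3N
    decides all larger integers. *)
Lemma table_complete z : h < z -> table z \/ sum3 table z.
Proof.
have [n] := ubnP z; elim: n => // n IHn in z * => lt_zn lt_hz.
have /and3P[_ _ /allP/(_ z)] := certificate; rewrite mem_iota => certz.
have [lt_z|le_z] := ltnP z (3 * N + p + 1).
  have := certz ltac:(lia); case: ifP => [tz _|_]; first by left.
  rewrite /table_sum3 /has_first -has_find => /hasP[a].
  rewrite mem_window => /andP[ta _]; rewrite -has_find => /hasP[b].
  rewrite mem_window => /andP[tb _]; case: ifP => // /andP[ab bz] tz.
  by right; exists a, b, (z - a - b); split=> //; lia.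
have table_add x : N <= x -> table (x + p) = table x.
  by move=> le_Nx; have := table_periodic 1 le_Nx; rewrite mul1n.
have [|||[a [b [c [ta tb tc abc def_z]]]]] := IHn (z - p); try lia.
  by rewrite -table_add ?subnK; [left|lia|lia].
right; exists a, b, (c + p); split=> //; try lia.
by rewrite table_add //; lia.
Qed.

Lemma table_model : greedy_model f g h table.
Proof.
have /and3P[/eqP def_init _ _] := certificate.
split; last exact: table_complete; last first.
  by move=> a b c ta tb tc ltabc; apply/negP; apply: table_sumfree => //; lia.
move=> z le_zh.
have -> : table z = (z \in [:: f; g; h]).
  by rewrite -def_init mem_filter mem_iota add0n ltnS le_zh !andbT.
rewrite !inE; split=> [/or3P[]/eqP->|].
- by constructor 1.
- by constructor 2.
- by constructor 3.
by case=> ->; rewrite eqxx ?orbT.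
Qed.

Lemma certified_periodic : f < g -> g < h ->
  ultimately_periodic (char_seq (sumfree3 f g h)).
Proof.
move=> lt_fg lt_gh.
apply: (greedy_model_periodic lt_fg lt_gh table_model p_gt0) => z le_z.
by have := table_periodic 1 le_z; rewrite mul1n => ->.
Qed.

End FiniteCheck.

Lemma periodic_1_2_4 : ultimately_periodic (char_seq (sumfree3 1 2 4)).
Proof.
by apply: (@certified_periodic 1 2 4 58 13
  [:: 1; 2; 4; 5; 6; 14; 16; 18; 30; 42; 43; 44; 56] [:: 11; 12]); vm_compute.
Qed.

Lemma periodic_1_2_5 : ultimately_periodic (char_seq (sumfree3 1 2 5)).
Proof.
by apply: (@certified_periodic 1 2 5 8 5 [:: 1; 2; 5; 6; 7] [:: 3]); vm_compute.
Qed.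

Lemma periodic_1_3_7 : ultimately_periodic (char_seq (sumfree3 1 3 7)).
Proof.
by apply: (@certified_periodic 1 3 7 16 27
  [:: 1; 3; 7; 8; 9; 10; 15] [:: 13; 19; 20]); vm_compute.
Qed.

Lemma periodic_1_4_9 : ultimately_periodic (char_seq (sumfree3 1 4 9)).
Proof.
by apply: (@certified_periodic 1 4 9 80 104
  [:: 1; 4; 9; 10; 11; 12; 13; 19; 37; 45; 46; 72; 79]
  [:: 0; 1; 34; 35; 36; 43; 69; 70; 78; 96]); vm_compute.
Qed.

Theorem theorem3 (d f g : nat) (hd : 1 <= d) (hf : 1 <= f)
    (hg : maxn (f + 1) (d - 1) <= g) :
  ultimately_periodic (char_seq (sumfree3 f g (g + d))).
Proof.
have [lt_fg le_dg] : f < g /\ d - 1 <= g by lia.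
have [->|d_neq1] := eqVneq d 1; first exact: periodic_alternating_blocks.
have [lt_dfg|le_fgd] := ltnP d (f + g).
  have [lt3|le3] := ltnP 3 (f + g); first by apply: periodic_single_blocks; lia.
  have [-> -> ->] : [/\ f = 1, g = 2 & d = 2] by split; lia.
  exact: periodic_1_2_4.
have -> : f = 1 by lia.
have -> : g + d = 2 * d - 1 by lia.
have -> : g = d - 1 by lia.
have [lt5|le5] := ltnP 5 d; first exact: periodic_extremal_blocks.
have [->|[->|->]] : d = 3 \/ d = 4 \/ d = 5 by lia.
- exact: periodic_1_2_5.
- exact: periodic_1_3_7.
exact: periodic_1_4_9.
Qed.
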